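(* Let $H$ be a uniformly random directed hypergraph with degree sequence $((d_v^{\mathrm{out}},d_v^{\mathrm{in}})_{v\in V},(\delta_e^{\mathrm{tail}},\delta_e^{\mathrm{head}})_{e\in E})$, where $n=|V|$, and suppose that for all $e\in E$: $\delta_e^{\mathrm{tail}} \leq \frac{1}{2}n \mathbb{E}[d_U^{\mathrm{out}}]$ and $\delta_e^{\mathrm{head}} \leq \frac{1}{2}n \mathbb{E}[d_U^{\mathrm{in}}]$. Let $M_n$ be the number of multi-hyperedge pairs. Write $\delta_{e'}=\delta_e$ for ($\delta_{e'}^{\mathrm{tail}}=\delta_e^{\mathrm{tail}}$ and $\delta_{e'}^{\mathrm{head}}=\delta_e^{\mathrm{head}}$). Then $$\mathbb{E}[M_n] = \frac{1}{2} \sum_{e \in E} \sum_{\substack{e' \in E\setminus\{e\}:\\ \delta_{e'}=\delta_e}} \frac{(n\mathbb{E}[d_U^{\mathrm{out}}]-2\delta_e^{\mathrm{tail}})!\,(n\mathbb{E}[d_U^{\mathrm{in}}]-2\delta_e^{\mathrm{head}})!}{(n\mathbb{E}[d_U^{\mathrm{out}}])!\,(n\mathbb{E}[d_U^{\mathrm{in}}])!}\; T_e\; S_e,$$ where $$T_e=\sum_{\substack{\mathbf{a} \in \mathbb{N}^{\delta_e^{\mathrm{tail}}}:\\ \sum_{i}ia_i = \delta_e^{\mathrm{tail}}}} \frac{\delta_e^{\mathrm{tail}}!^2}{\prod_{k=1}^{\delta_e^{\mathrm{tail}}} k!^{2a_k} } \sum_{\alpha \in R(\mathbf{a})} (-1)^{\sum_{\mathbf{x}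 \in \mathbb{N}^{\delta_e^{\mathrm{tail}}}} (\sum_{i} x_i - 1)\alpha(\mathbf{x})} \prod_{\mathbf{y} \in \mathbb{N}^{\delta_e^{\mathrm{tail}}}} \left( \frac{1}{\alpha(\mathbf{y})!} \left(\frac{n\,\mathbb{E}\left[\prod_{i=1}^{\delta_e^{\mathrm{tail}}} \left(\mathbf{1}_{\{d_U^{\mathrm{out}} \geq 2i\}}\frac{d_U^{\mathrm{out}}!}{(d_U^{\mathrm{out}}-2i)!}\right)^{y_i} \right]\left(\sum_{i=1}^{\delta_e^{\mathrm{tail}}} y_i-1 \right)!}{\prod_{i=1}^{\delta_e^{\mathrm{tail}}} y_i!} \right)^{\alpha(\mathbf{y})} \right)$$ and $$S_e=\sum_{\substack{\mathbf{b} \in \mathbb{N}^{\delta_e^{\mathrm{head}}}:\\ \sum_{i}ib_i = \delta_e^{\mathrm{head}}}} \frac{\delta_e^{\mathrm{head}}!^2}{\prod_{k=1}^{\delta_e^{\mathrm{head}}} k!^{2b_k} }\sum_{\beta \in R(\mathbf{b})} (-1)^{\sum_{\mathbf{x} \in \mathbb{N}^{\delta_e^{\mathrm{head}}}} (\sum_{i} x_i - 1)\beta(\mathbf{x})} \prod_{\mathbf{z} \in \mathbb{N}^{\delta_e^{\mathrm{head}}}} \left( \frac{1}{\beta(\mathbf{z})!} \left(\frac{n\,\mathbb{E}\left[\prod_{i=1}^{\delta_e^{\mathrm{head}}} \left(\mathbf{1}_{\{d_U^{\mathrm{in}} \geq 2i\}}\frac{d_U^{\mathrm{in}}!}{(d_U^{\mathrm{in}}-2i)!}\right)^{z_i}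 \right]\left(\sum_{i=1}^{\delta_e^{\mathrm{head}}} z_i-1 \right)!}{\prod_{i=1}^{\delta_e^{\mathrm{head}}} z_i!} \right)^{\beta(\mathbf{z})} \right).$$
   Context: $\mathbb{N}$ contains $0$, and $0^0=1$. Let $V$ be a finite vertex set with $n=|V|$ and $E$ a finite set of (labelled) hyperedges. A directed degree sequence consists of vertex out- and in-degrees $d_v^{\mathrm{out}},d_v^{\mathrm{in}}\in\mathbb{N}$ ($v\in V$) and hyperedge tail- and head-degrees $\delta_e^{\mathrm{tail}},\delta_e^{\mathrm{head}}\in\mathbb{N}$ ($e\in E$) with $\sum_v d_v^{\mathrm{out}}=\sum_e\delta_e^{\mathrm{tail}}$ and $\sum_v d_v^{\mathrm{in}}=\sum_e\delta_e^{\mathrm{head}}$. A uniformly random (stub-labeled) directed hypergraph with this degree sequence is obtained as follows: each vertex $v$ has $d_v^{\mathrm{out}}$ distinguishable out-stubs and $d_v^{\mathrm{in}}$ distinguishable in-stubs; all out-stubs are distributed over the tails so that the tail of $e$ receives exactly $\delta_e^{\mathrm{tail}}$ out-stubs, and all in-stubs are distributed over the heads so that the head of $e$ receives exactly $\delta_e^{\mathrm{head}}$ in-stubs (slots within a tail or head are interchangeable); all such pairs of assignments are equally likely (so the out- and in-assignments are independent and uniform). Each hyperedge is then a pair $e=(e^{\mathrm{tail}},e^{\mathrm{head}})$ of multisets of vertices, where multiplicities count the stubs of a vertex in the tail and in the head. Two distinct hyperedges $e_1,e_2$ form a multi-hyperedge pair if $e_1^{\mathrm{tail}}=e_2^{\mathrm{tail}}$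 and $e_1^{\mathrm{head}}=e_2^{\mathrm{head}}$ as multisets; $M_n$ is the number of unordered multi-hyperedge pairs. $U$ is a uniformly chosen vertex of $V$, with out-degree $d_U^{\mathrm{out}}$ and in-degree $d_U^{\mathrm{in}}$. For $\delta\in\mathbb{N}$ and $\mathbf{a}\in\mathbb{N}^{\delta}$, $R(\mathbf{a})$ is the set of functions $\alpha:\mathbb{N}^{\delta}\to\mathbb{N}$ with $\alpha(\mathbf{0})=0$ and $\sum_{\mathbf{x}\in\mathbb{N}^{\delta}}x_i\,\alpha(\mathbf{x})=a_i$ for all $i\in\{1,\dots,\delta\}$. Factors of the products with $\alpha(\mathbf{y})=0$ or $\beta(\mathbf{z})=0$ (in particular $\mathbf{y}=\mathbf{0}$, $\mathbf{z}=\mathbf{0}$) are equal to $1$, and the indicator times the quotient is $0$ when the indicator is $0$. *)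

(* Defs.v *)
From mathcomp Require Import all_boot all_order all_algebra.
From mathcomp Require Import finmap multiset.
From mathcomp Require Import boolp classical_sets functions cardinality fsbigop.

Set Implicit Arguments.
Unset Strict Implicit.
Unset Printing Implicit Defensive.

Import GRing.Theory Num.Theory.

Local Open Scope ring_scope.
Local Open Scope mset_scope.

(* Expectation of [X] under the uniform distribution on [A]; it is 0 (by
   x / 0 = 0) when [A] is empty. *)
Definition unif_mean (R : archiRealFieldType) (T : finType) (A : {set T})
    (X : T -> R) : R :=
  (\sum_(w in A) X w) / #|A|%:R.

(* Factorial of a field element that is a natural number. *)
Definition fact_real (R : archiRealFieldType) (x : R) : R :=
  ((Num.truncn x)`!)%:R.

Section StubLabeledModel.
Variables V E : finType.

(* The distinguishable stubs of one kind (out or in). *)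
Definition stub (d : V -> nat) : finType := {v : V & 'I_(d v)}.

(* [f s] is the hyperedge whose tail (resp. head) receives the stub [s].  Slots
   inside a tail or head are interchangeable, so the map to hyperedges is the
   whole assignment. *)
Definition stub_assignments (d : V -> nat) (delta : E -> nat) :
    {set {ffun stub d -> E}} :=
  [set f : {ffun stub d -> E} |
    [forall e : E, #|[pred s | f s == e]| == delta e]]%SET.

(* The multiset of vertices whose stubs [f] sends to [e]. *)
Definition end_mset (d : V -> nat) (f : {ffun stub d -> E}) (e : E) : {mset V} :=
  seq_mset [seq tag s | s <- enum (stub d) & f s == e].

Definition dihypergraph (dout din : V -> nat) : finType :=
  ({ffun stub dout -> E} * {ffun stub din -> E})%type.

Definition dihypergraphs (dout din : V -> nat) (dtail dhead : E -> nat) :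
    {set dihypergraph dout din} :=
  finset.setX (stub_assignments dout dtail) (stub_assignments din dhead).

Definition same_hyperedge (dout din : V -> nat) (H : dihypergraph dout din)
    (e1 e2 : E) : bool :=
  (end_mset H.1 e1 == end_mset H.1 e2) && (end_mset H.2 e1 == end_mset H.2 e2).

Definition num_multi_pairs (dout din : V -> nat) (H : dihypergraph dout din) :
    nat :=
  #|[set P : {set E} | [exists e1 : E, exists e2 : E,
       [&& e1 != e2, P == [set e1; e2] & same_hyperedge H e1 e2]]]%SET|.

End StubLabeledModel.

(* N^k; the coordinate with 1-based index j is the one at [i : 'I_k] with
   i.+1 = j. *)
Definition natvec (k : nat) := {ffun 'I_k -> nat}.

(* The (possibly infinite) sum of the naturals [F x] converges to [s].  The
   finiteness clause is needed because [\big[addn/0]_(x \in _)] is 0 when the support is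
   infinite. *)
Definition nat_sum_to (T : choiceType) (F : T -> nat) (s : nat) : Prop :=
  finite_set [set x | F x != 0%N]%classic /\
  \big[addn/0%N]_(x \in [set: T]%classic) F x = s.

Definition Rset (k : nat) (a : natvec k) : set (natvec k -> nat) :=
  [set alpha : natvec k -> nat | alpha [ffun=> 0%N] = 0%N /\
     forall i : 'I_k, nat_sum_to (fun x : natvec k => (x i * alpha x)%N) (a i)]%classic.

Section SideSum.
Variables (R : archiRealFieldType) (V : finType) (d : V -> nat) (k : nat).

Definition falling_moment (y : natvec k) : R :=
  unif_mean [set: V]%SET (fun v =>
    \prod_(i < k) ((2 * i.+1 <= d v)%N%:R *
                   ((d v)`!%:R / (d v - 2 * i.+1)`!%:R)) ^+ y i).

(* At y = 0 the truncated predecessor replaces -1 by 0; this is harmless since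
   every [alpha] in use vanishes there. *)
Definition side_factor (alpha : natvec k -> nat) (y : natvec k) : R :=
  (alpha y)`!%:R^-1 *
  (#|V|%:R * falling_moment y * ((\sum_(i < k) y i).-1)`!%:R
     / (\prod_(i < k) (y i)`!)%N%:R) ^+ alpha y.

(* The sums over [\in] below range over sets with finitely many contributing
   elements, and the product has finitely many factors different from 1, as
   [alpha] in [Rset a] is finitely supported. *)
Definition side_sum : R :=
  \sum_(a \in [set a : natvec k | (\sum_(i < k) i.+1 * a i)%N = k]%classic)
    ((k`!%:R ^+ 2 / \prod_(j < k) (j.+1)`!%:R ^+ (2 * a j)) *
     \sum_(alpha \in Rset a)
       ((-1) ^+ (\big[addn/0%N]_(x \in [set: natvec k]%classic)
                   ((\sum_(i < k) x i).-1 * alpha x)%N) *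
        \big[*%R/1]_(y \in [set: natvec k]%classic) side_factor alpha y)).

End SideSum.

(* Main.v *)
Require Import Defs.
From mathcomp Require Import finmap multiset.
From mathcomp Require Import boolp classical_sets functions cardinality fsbigop.
From mathcomp Require Import all_boot all_order all_algebra.
From mathcomp Require Import zify ring lra.
Set Implicit Arguments.
Unset Strict Implicit.
Unset Printing Implicit Defensive.
Import GRing.Theory Num.Theory.

(** Twice the number of multi-hyperedge pairs is the number of ordered pairs
    [e <> e'] with equal tails and equal heads ([double_num_multi_pairs]), and
    for a fixed pair the tails and the heads are independent.  So everything
    reduces to one side: if [e] and [e'] both have [k] slots and there are [N]
    stubs, what is the probability that they receive the same multiset of
    vertices ([side_probability])?

    Counting.  Label each stub by whether it goes to [e], to [e'] or elsewhere.
    If vertex [v] is to appear [m v] times in [e] and in [e'], the labels can be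
    chosen in [d v ^_ (2 m v) / (m v)!^2] ways at [v], and a labelling extends to
    an assignment of all stubs in a multinomial number of ways which does not
    depend on it.  Both counts are instances of one multinomial formula with
    prescribed fibres inside prescribed blocks ([card_tagged_fill]).  The
    probability is therefore
      (N - 2k)! / N! * k!^2 * \sum_(m | \sum_v m v = k) \prod_v d v ^_ (2 m v) / (m v)!^2.

    Symmetric functions.  Put [F i v = d v ^_ (2 i)] and sort the functions [m] by
    the vector [a], where [a_i] is the number of [v] with [m v = i].  What remains
    is the coefficient of [t^a] in
      \prod_v (1 + \sum_i t_i F i v)  =  exp (\sum_v log (1 + \sum_i t_i F i v)).
    The coefficient of [t^x] in the exponent is, for [x] nonzero,
      c_x = (-1)^(|x|-1) (|x|-1)! / \prod_i x_i! * \sum_v \prod_i (F i v)^(x_i),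
    and expanding the product over [x] of the series exp (c_x t^x) turns the
    coefficient into the sum over [R(a)] of \prod_x c_x^(alpha x) / (alpha x)!
    ([elem_sum_exp]).

    No power series are manipulated.  An exponential E = exp C is characterised
    by its constant term and by the equations t_i dE/dt_i = (t_i dC/dt_i) E,
    which on coefficients read
      a_i E_a = \sum_(x <= a) x_i c_x E_(a - x)
    and determine E_a by induction on the degree of [a] ([newton_unique]).  Both
    sides satisfy them: the coefficients of the product by adding one vertex at a
    time ([elem_sum_newton]), the sums over [R(a)] by removing one occurrence of
    [x] from [alpha] ([exp_sum_newton]). *)

(** * Functions with prescribed fibres *)

Section TaggedMultinomial.
Variables (T V C : finType) (tg : T -> V).

(** Keeping the values outside [A] pinned to [p] makes the family closed under
    removing a point from [A], so that no function is ever restricted to a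
    subtype. *)
Definition tagged_fill (A : {set T}) (p : {ffun T -> C}) (delta : V -> C -> nat) :
    {set {ffun T -> C}} :=
  [set f : {ffun T -> C} | [forall t, (t \in A) || (f t == p t)] &&
    [forall v, forall c,
      #|[set t in A | (tg t == v) && (f t == c)]| == delta v c]].

Definition class_size (A : {set T}) (v : V) : nat := #|[set t in A | tg t == v]|.

(** The product of multinomial coefficients, by induction on [#|A|]: split
    according to the colour [c] of one point of [A], which lies in block [w].
    The functions with that colour are again a family of the same kind, with
    [delta w c] decreased by one, and [\sum_c delta w c] is the size of block [w]. *)
Lemma card_tagged_fill (A : {set T}) (p : {ffun T -> C}) (delta : V -> C -> nat) :
  (forall v, \sum_c delta v c = class_size A v) ->
  #|tagged_fill A p delta| * \prod_v \prod_c (delta v c)`!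
    = \prod_v (class_size A v)`!.
Proof.
elim: {A}_.+1 {-2}A (ltnSn #|A|) p delta => // N IH A leAN p delta sumdelta.
have [A0|[t tA]] := set_0Vmem A.
  have sz0 v : class_size A v = 0.
    by rewrite /class_size A0; apply: eq_card0 => t; rewrite !inE.
  have d0 v c : delta v c = 0.
    by apply/eqP; rewrite -leqn0 -(sz0 v) -sumdelta (bigD1 c) //= leq_addr.
  rewrite [X in _ = X]big1 => [|v _]; last by rewrite sz0.
  rewrite [X in _ * X]big1 => [|v _]; last by rewrite big1 // => c _; rewrite d0.
  rewrite muln1 (_ : tagged_fill _ _ _ = [set p]) ?cards1 //.
  apply/setP => f; rewrite !inE A0; apply/andP/eqP => [[/forallP fp _]|->].
    by apply/ffunP => t; have := fp t; rewrite inE => /eqP.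
  split; first by apply/forallP => t; rewrite inE eqxx.
  by apply/'forall_'forall_eqP => v c; rewrite d0; apply: eq_card0 => t; rewrite !inE.
set w := tg t.
pose delta' c v c' := delta v c' - ((v == w) && (c' == c)).
pose p' c := [ffun s => if s == t then c else p s].
have fiber c : [set f in tagged_fill A p delta | f t == c] =
    if 0 < delta w c then tagged_fill (A :\ t) (p' c) (delta' c) else set0.
  have cnt (f : {ffun T -> C}) v c' : #|[set s in A | (tg s == v) && (f s == c')]| =
     ((w == v) && (f t == c')) + #|[set s in A :\ t | (tg s == v) && (f s == c')]|.
    rewrite (cardsD1 t) inE tA /=; congr (_ + _); apply: eq_card => s.
    by rewrite !inE andbA.
  apply/setP => f; rewrite inE.
  have [dpos|d0] := ltnP 0 (delta w c); last first.
    rewrite in_set0; apply/negbTE/negP => /andP[]; rewrite inE => /andP[_].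
    move=> /'forall_'forall_eqP/(_ w c) fib /eqP ftc.
    by move: fib d0; rewrite cnt ftc !eqxx /= => <-.
  rewrite !inE; apply/andP/andP => [[/andP[/forallP fp /'forall_'forall_eqP fib] /eqP ftc]|].
    split.
      apply/forallP => s; rewrite !inE ffunE.
      by have := fp s; case: (eqVneq s t) => //= -> _; rewrite ftc eqxx.
    apply/'forall_'forall_eqP => v c'; rewrite /delta' -fib cnt ftc.
    by rewrite [w == v]eq_sym [c == c']eq_sym addKn.
  move=> [/forallP fp /'forall_'forall_eqP fib].
  have /eqP ftc : f t == c by have := fp t; rewrite !inE eqxx /= ffunE eqxx.
  rewrite ftc eqxx; split=> //; apply/andP; split.
    apply/forallP => s; have := fp s; rewrite !inE ffunE.
    by case: (eqVneq s t) => [->|] //=; rewrite tA.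
  apply/'forall_'forall_eqP => v c'; rewrite cnt fib /delta' ftc.
  rewrite [w == v]eq_sym [c == c']eq_sym.
  by case: eqP => [->|]; case: eqP => [->|] //=; rewrite ?subn0 // subnKC.
have sz v : class_size A v = (w == v) + class_size (A :\ t) v.
  rewrite /class_size (cardsD1 t) inE tA /=; congr (_ + _); apply: eq_card => s.
  by rewrite !inE andbA.
have cardE : #|tagged_fill A p delta| =
    \sum_c #|[set f in tagged_fill A p delta | f t == c]|.
  rewrite -sum1_card (partition_big (fun f : {ffun T -> C} => f t) predT) //=.
  by apply: eq_bigr => c _; rewrite -sum1_card; apply: eq_bigl => f; rewrite !inE.
rewrite cardE big_distrl /=.
have step c : #|[set f in tagged_fill A p delta | f t == c]|
     * \prod_v \prod_c' (delta v c')`! =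
   delta w c * \prod_v (class_size (A :\ t) v)`!.
  rewrite fiber; case: posnP => [->|dpos]; first by rewrite cards0.
  have sum' v : \sum_c' delta' c v c' = class_size (A :\ t) v.
    apply/(@addnI (w == v)); rewrite -sz -sumdelta.
    rewrite (bigD1 c) //= [RHS](bigD1 c) //= addnA; congr (_ + _).
      by rewrite /delta' eqxx andbT eq_sym; case: eqP => [->|] //=; rewrite ?subnKC ?subn0.
    by apply: eq_bigr => c' /negbTE ne; rewrite /delta' ne andbF subn0.
  rewrite -(IH (A :\ t) _ (p' c) (delta' c)) //; last first.
    by move: leAN; rewrite (cardsD1 t) tA.
  rewrite mulnCA; congr (_ * _).
  rewrite (bigD1 w) //= [in RHS](bigD1 w) //= mulnA; congr (_ * _).
    rewrite (bigD1 c) //= [in RHS](bigD1 c) //= mulnA; congr (_ * _).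
      by rewrite /delta' !eqxx /= subn1 -[in LHS](prednK dpos) factS prednK.
    by apply: eq_bigr => c' /negbTE ne; rewrite /delta' ne andbF subn0.
  by apply: eq_bigr => v /negbTE ne; apply: eq_bigr => c' _; rewrite /delta' ne subn0.
rewrite (eq_bigr _ (fun c _ => step c)) -big_distrl /= sumdelta.
rewrite (bigD1 w) //= [in RHS](bigD1 w) //= mulnA; congr (_ * _).
  by rewrite sz eqxx add1n factS.
by apply: eq_bigr => v; rewrite eq_sym sz => /negbTE->.
Qed.

End TaggedMultinomial.

(** * Stub assignments that give two hyperedges the same end *)

Section BalancedCount.
Variables (V E : finType) (d : V -> nat).
Local Notation S := (stub d).
Local Notation N := (\sum_v d v).

Lemma card_stub : #|S| = N.
Proof. by rewrite card_tagged sumnE big_map big_enum; apply: eq_bigr => v _; rewrite card_ord. Qed.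

Lemma class_size_stub (v : V) : class_size (fun s : S => tag s) setT v = d v.
Proof.
rewrite /class_size -[RHS]card_ord -(card_image (f := fun i : 'I_(d v) => Tagged (fun v => 'I_(d v)) i)).
  apply: eq_card => -[w i]; rewrite !inE /=; apply/eqP/imageP => [wv|[j _ ij]].
    by case: _ / wv; exists i.
  by have := congr1 tag ij.
by move=> i j /eqP; rewrite -tag_eqE /tag_eq eqxx /= tagged_asE => /eqP.
Qed.

Definition end_mult (C : eqType) (f : {ffun S -> C}) (c : C) (v : V) : nat :=
  #|[set s | (tag s == v) && (f s == c)]|.

Lemma end_mset_eq (f : {ffun S -> E}) e1 e2 :
  (end_mset f e1 == end_mset f e2) = [forall v, end_mult f e1 v == end_mult f e2 v].
Proof.
have mE e v : end_mset f e v = end_mult f e v.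
  rewrite /end_mset mset_seqE count_map count_filter /end_mult cardE /enum_mem size_filter.
  rewrite count_filter -enumT; apply: eq_count => s /=.
  by rewrite !inE andbT.
apply/eqP/'forall_eqP => [eqe v|eqe]; first by rewrite -!mE eqe.
by apply/msetP => v; rewrite !mE.
Qed.

Lemma sum_end_mult (C : finType) (f : {ffun S -> C}) c :
  \sum_v end_mult f c v = #|[set s | f s == c]|.
Proof.
rewrite -[RHS]sum1_card (partition_big (fun s : S => tag s) predT) //=.
apply: eq_bigr => v _; rewrite /end_mult -sum1_card.
by apply: eq_bigl => s; rewrite !inE andbC.
Qed.

Lemma big_option_bool (R : Type) (idx : R) (op : Monoid.com_law idx) (F : option bool -> R) :
  \big[op/idx]_c F c = op (F (Some true)) (op (F (Some false)) (F None)).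
Proof.
rewrite (bigD1 (Some true)) //= (bigD1 (Some false)) //= (bigD1 None) //=.
by rewrite big1 ?Monoid.mulm1 // => -[[]|].
Qed.

(** [Some true] marks the stubs sent to the first of two hyperedges, [Some false]
    those sent to the second, and [None] all others. *)
Definition balanced_labels (k : nat) : {set {ffun S -> option bool}} :=
  [set g : {ffun S -> option bool} |
    [forall v, end_mult g (Some true) v == end_mult g (Some false) v] &&
    (#|[set s | g s == Some true]| == k)].

(** At a vertex used [m v] times on each side, the labels are chosen independently
    of the other vertices: 'C(d v, 2 * m v) choices of the stubs that get a label
    [Some _], and 'C(2 * m v, m v) ways to share them equally. *)
Lemma card_balanced_labels k :
  #|balanced_labels k| = \sum_(m : {ffun V -> 'I_k.+1} | \sum_v m v == k)
     \prod_v ('C(d v, 2 * m v) * 'C(2 * m v, m v)).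
Proof.
pose prof (g : {ffun S -> option bool}) : {ffun V -> 'I_k.+1} :=
  [ffun v => inord (end_mult g (Some true) v)].
have le g v : g \in balanced_labels k -> end_mult g (Some true) v <= k.
  rewrite inE => /andP[_ /eqP <-]; rewrite -sum_end_mult.
  by rewrite (bigD1 v) //= leq_addr.
rewrite -sum1_card (partition_big prof (fun m => \sum_v m v == k)) /=; last first.
  move=> g gk; rewrite (eq_bigr (end_mult g (Some true))) => [|v _].
    by rewrite sum_end_mult; move: gk; rewrite inE => /andP[].
  by rewrite ffunE inordK // ltnS le.
apply: eq_bigr => m /eqP summ.
have cls (g : {ffun S -> option bool}) v : 
    end_mult g (Some true) v + (end_mult g (Some false) v + end_mult g None v) = d v.
  rewrite -(class_size_stub v) /class_size -sum1_card.
  rewrite (partition_big g predT) //= big_option_bool /=.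
  rewrite /end_mult -!sum1_card; do ![congr (_ + _)];
  by apply: eq_bigl => s; rewrite !inE /=.
(* If some vertex has too few stubs for [m], both sides vanish. *)
have [/forallP dm|/forallPn[v]] := boolP [forall v, 2 * m v <= d v]; last first.
  rewrite -ltnNge => ltv; rewrite [RHS](bigD1 v) //= bin_small // mul0n mul0n.
  rewrite big1 // => g /andP[gk /eqP gm]; exfalso.
  move: (le g v gk) => lev.
  have mv : m v = end_mult g (Some true) v :> nat by rewrite -gm ffunE inordK.
  move: gk; rewrite inE => /andP[/'forall_eqP/(_ v) eqv _].
  by have := cls g v; rewrite -eqv -mv; lia.
pose dl v (c : option bool) : nat := if c is Some _ then m v : nat else d v - 2 * m v.
rewrite sum1_card.
have -> : #|[pred g in balanced_labels k | prof g == m]|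
   = #|tagged_fill (fun s : S => tag s) setT [ffun=> None] dl|.
  apply: eq_card => g; rewrite [LHS]inE [RHS]inE.
  have -> /= : [forall t, (t \in [set: S]) || (g t == [ffun=> None] t)].
    by apply/forallP => t; rewrite inE.
  rewrite (_ : [forall v, _] = [forall v, forall c, end_mult g c v == dl v c]); last first.
    apply/eq_forallb => v; apply/eq_forallb => c; rewrite /end_mult; congr (_ == _).
    by apply: eq_card => s; rewrite !inE.
  apply/andP/'forall_'forall_eqP => [[gk /eqP gm]|gd].
    have mv v : end_mult g (Some true) v = m v by rewrite -gm ffunE inordK // ltnS le.
    have mv' v : end_mult g (Some false) v = m v.
      by move: gk; rewrite inE => /andP[/'forall_eqP/(_ v) <-].
    move=> v [[]|] /=; rewrite ?mv ?mv' //.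
    by have := cls g v; rewrite mv mv' => <-; rewrite addnA addnn mul2n addKn.
  split.
    rewrite inE; apply/andP; split; first by apply/'forall_eqP => v; rewrite !gd.
    rewrite -sum_end_mult (eq_bigr (fun v => m v : nat)) ?summ //.
  by apply/eqP/ffunP => v; apply/val_inj; rewrite ffunE gd /= inord_val.
have := @card_tagged_fill _ _ _ (fun s : S => tag s) setT [ffun=> None] dl.
have pos : 0 < \prod_v \prod_c (dl v c)`!.
  by rewrite prodn_gt0 // => v; rewrite prodn_gt0 // => c; rewrite fact_gt0.
move=> H; apply/eqP; rewrite -(eqn_pmul2r pos) H => [|v].
  rewrite -big_split /=; apply/eqP/eq_bigr => v _; rewrite class_size_stub.
  rewrite big_option_bool /=.
  have /bin_fact <- := dm v.
  have le2 : m v <= 2 * m v by lia.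
  have <- := bin_fact le2; rewrite (_ : 2 * m v - m v = m v); last lia.
  by rewrite -!mulnA; congr (_ * _); rewrite [RHS]mulnC -!mulnA.
by rewrite class_size_stub big_option_bool /=; have := dm v; lia.
Qed.

(** The multinomial formula with a single block. *)
Lemma card_stub_assignments (delta : E -> nat) : N = \sum_e delta e ->
  #|stub_assignments d delta| * \prod_e (delta e)`! = N`!.
Proof.
move=> sumd.
(* Pinning needs a default hyperedge; without one there are no stubs. *)
have [e0|E0] := pickP (fun _ : E => true); last first.
  have sumd0 : N = 0 by rewrite sumd big_pred0.
  rewrite [in RHS]sumd0 big_pred0 // muln1 fact0.
  have noS (s : S) : False.
    by have := max_card (pred1 s); rewrite card1 card_stub sumd0.
  rewrite (_ : stub_assignments d delta = [set (finfun (fun s => False_rect E (noS s)))]) ?cards1 //.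
  apply/setP => f; rewrite !inE; apply/forallP/eqP => [_|_ e].
    by apply/ffunP => s; case: (noS s).
  by have := E0 e.
have := @card_tagged_fill _ _ _ (fun _ : S => tt) setT [ffun=> e0] (fun _ => delta).
have cs v : class_size (fun _ : S => tt) setT v = N.
  by rewrite /class_size -card_stub; apply: eq_card => s; rewrite !inE; case: v.
have bu (F : unit -> nat) : \prod_v F v = F tt.
  by rewrite (bigD1 tt) //= big1 ?muln1 // => -[].
rewrite !bu cs => <-; last by move=> v; rewrite cs sumd.
move=> _; congr (_ * _); apply: eq_card => f; rewrite !inE.
have -> /= : [forall t, (t \in [set: S]) || (f t == [ffun=> e0] t)].
  by apply/forallP => t; rewrite inE.
apply/'forall_eqP/'forall_'forall_eqP => [fd v e|fd e].
  by rewrite -fd; apply: eq_card => s; rewrite !inE; case: v.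
by rewrite -(fd tt e); apply: eq_card => s; rewrite !inE.
Qed.

(** A balanced assignment is a balanced labelling together with a distribution of
    the unlabelled stubs over the other hyperedges; the number of the latter is
    the multinomial coefficient [(N - 2 k)! / \prod_x delta x !], whatever the
    labelling. *)
Lemma card_balanced_assignments (delta : E -> nat) e e' :
  N = \sum_e delta e -> e != e' -> delta e = delta e' ->
  #|[set f in stub_assignments d delta | end_mset f e == end_mset f e']|
     * \prod_(x | (x != e) && (x != e')) (delta x)`!
  = (N - 2 * delta e)`! * #|balanced_labels (delta e)|.
Proof.
move=> sumd ne deq; set k := delta e.
pose lab (f : {ffun S -> E}) : {ffun S -> option bool} :=
  [ffun s => if f s == e then Some true else if f s == e' then Some false else None].
have labT f s : (lab f s == Some true) = (f s == e).
  by rewrite ffunE; case: (f s == e); last case: (f s == e').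
have labF f s : (lab f s == Some false) = (f s == e').
  rewrite ffunE; case: (eqVneq (f s) e) => [->|_]; last by case: (f s == e').
  by rewrite (negbTE ne).
have labN f s : (lab f s == None) = (f s != e) && (f s != e').
  by rewrite ffunE; case: (f s == e); last case: (f s == e').
have labTm f v : end_mult (lab f) (Some true) v = end_mult f e v.
  by apply: eq_card => s; rewrite !inE labT.
have labFm f v : end_mult (lab f) (Some false) v = end_mult f e' v.
  by apply: eq_card => s; rewrite !inE labF.
rewrite -sum1_card (partition_big lab (mem (balanced_labels k))) /=; last first.
  move=> f; rewrite !inE end_mset_eq => /andP[/'forall_eqP fd /'forall_eqP fe].
  apply/andP; split; first by apply/'forall_eqP => v; rewrite labTm labFm.
  by rewrite /k -fd; apply/eqP/eq_card => s; rewrite !inE labT.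
rewrite big_distrl /= [RHS]mulnC -sum_nat_const; apply: eq_bigr => g gk.
pose A : {set S} := [set s | g s == None].
pose p : {ffun S -> E} := [ffun s => if g s == Some true then e else e'].
pose dl (_ : unit) x := if (x != e) && (x != e') then delta x else 0.
have fib (f : {ffun S -> E}) : (\sum_x #|[pred s | f s == x]|) = N.
  rewrite -card_stub -sum1_card (partition_big f predT) //=.
  by apply: eq_bigr => x _; rewrite sum1_card; apply: eq_card => s; rewrite !inE.
move: (gk); rewrite inE => /andP[/'forall_eqP gb /eqP gT].
have gF : #|[set s | g s == Some false]| = k.
  by rewrite -gT -!sum_end_mult; apply: eq_bigr.
have cA v : class_size (fun _ : S => tt) A v = N - 2 * k.
  have : #|[set s | g s == Some true]| + (#|[set s | g s == Some false]| + #|A|) = N.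
    rewrite -card_stub -[RHS]sum1_card [RHS](partition_big g predT) //= big_option_bool.
    by rewrite -!sum1_card /=; do ![congr (_ + _)]; apply: eq_bigl => s; rewrite !inE.
  rewrite gT gF => <-; rewrite (_ : class_size _ _ _ = #|A|); first by lia.
  by apply: eq_card => s; rewrite !inE; case: v; rewrite andbT.
have bu (F : unit -> nat) : \prod_v F v = F tt.
  by rewrite (bigD1 tt) //= big1 ?muln1 // => -[].
have sumdl : \sum_x dl tt x = N - 2 * k.
  rewrite sumd (bigD1 e) //= (bigD1 e') 1?eq_sym //= [in RHS](bigD1 e) //=.
  rewrite [in RHS](bigD1 e') 1?eq_sym //= /dl !eqxx /= andbF !add0n -deq -/k.
  rewrite addnA addnn -mul2n addKn; apply: eq_bigr => x /andP[-> ->] //.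
have := @card_tagged_fill _ _ _ (fun _ : S => tt) A p dl.
rewrite !bu cA => <-; last by move=> v; rewrite cA; case: v.
congr (_ * _); last first.
  by rewrite big_mkcond /=; apply: eq_bigr => x _; rewrite /dl; case: ifP.
rewrite sum1_card; apply: eq_card => f; rewrite unfold_in !inE.
apply/idP/andP => [/andP[/andP[/'forall_eqP fd _] /eqP fg]|[/forallP fp /'forall_'forall_eqP fd]].
  split.
    apply/forallP => s; rewrite !inE !ffunE -fg labN labT.
    by case: (eqVneq (f s) e) => //= ?; case: eqP.
  apply/'forall_'forall_eqP => v x; rewrite /dl; case: ifP => [/andP[xe xe']|/negbT nx].
    rewrite -fd; apply: eq_card => s; rewrite !inE /= -fg labN; case: v => /=.
    by case: (eqVneq (f s) x) => [->|_]; rewrite ?xe ?xe' ?andbF.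
  apply: eq_card0 => s; rewrite !inE -fg labN.
  by apply/negbTE/negP => /and3P[h _ /eqP fx]; rewrite fx (negbTE nx) in h.
have fg : lab f = g.
  apply/ffunP => s; rewrite ffunE.
  have := fp s; rewrite !inE ffunE; case gs: (g s) => [[]|] /=.
  - by move=> /eqP->; rewrite eqxx.
  - by move=> /eqP->; rewrite eq_sym (negbTE ne) eqxx.
  move=> _.
  have nope x : (x != e) && (x != e') = false -> f s != x.
    move=> nx; apply/eqP => fx.
    have := fd tt x; rewrite /dl nx => /eqP; rewrite cards_eq0 => /eqP/setP/(_ s).
by rewrite !inE gs fx !eqxx.
  by rewrite (negbTE (nope e _)) ?eqxx // (negbTE (nope e' _)) ?eqxx ?andbF.
rewrite fg eqxx andbT; apply/andP; split; last first.
  by rewrite end_mset_eq; apply/'forall_eqP => v; rewrite -labTm -labFm fg.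
apply/'forall_eqP => x.
have [->|xe] := eqVneq x e.
  by rewrite -[delta e]gT -fg; apply: eq_card => s; rewrite !inE labT.
have [->|xe'] := eqVneq x e'.
  by rewrite -deq -[delta e]gF -fg; apply: eq_card => s; rewrite !inE labF.
have := fd tt x; rewrite /dl xe xe' /= => <-; apply: eq_card => s; rewrite !inE /=.
by rewrite -fg labN; case: (eqVneq (f s) x) => [->|_]; rewrite ?xe ?xe' ?andbF.
Qed.

End BalancedCount.

Local Open Scope ring_scope.

(** * Coefficients of a product of affine forms *)

Section Exponents.
Variable k : nat.
Implicit Types (a b x y : natvec k) (j : 'I_k).

Definition zero_vec : natvec k := [ffun=> 0%N].
Definition unit_vec j : natvec k := [ffun i => (i == j : nat)].
Definition add_vec x y : natvec k := [ffun i => (x i + y i)%N].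
Definition sub_vec x y : natvec k := [ffun i => (x i - y i)%N].
Definition le_vec x y : bool := [forall i, x i <= y i]%N.
Definition deg x : nat := (\sum_i x i)%N.

Lemma le_vecP x y : reflect (forall i, x i <= y i)%N (le_vec x y).
Proof. exact: forallP. Qed.

(** The exponents that divide [a], in other words the range of summation in a
    Cauchy product. *)
Definition box a : seq (natvec k) :=
  [seq [ffun i => y i : nat] | y : {dffun forall i, 'I_(a i).+1}
     <- enum {dffun forall i, 'I_(a i).+1}].

Lemma mem_box a x : (x \in box a) = le_vec x a.
Proof.
apply/mapP/le_vecP => [[y _ ->] i|xa].
  by rewrite ffunE -ltnS ltn_ord.
exists [ffun i => inord (x i)]; first by rewrite mem_enum.
by apply/ffunP => i; rewrite !ffunE inordK // ltnS.
Qed.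

Lemma box_uniq a : uniq (box a).
Proof.
rewrite map_inj_uniq ?enum_uniq // => y z /ffunP yz.
by apply/ffunP => i; apply/val_inj; have := yz i; rewrite !ffunE.
Qed.

Lemma add_vecK x y : sub_vec (add_vec x y) y = x.
Proof. by apply/ffunP => i; rewrite !ffunE addnK. Qed.

Lemma sub_vecK x y : le_vec y x -> add_vec (sub_vec x y) y = x.
Proof. by move=> /le_vecP yx; apply/ffunP => i; rewrite !ffunE subnK. Qed.

Lemma le_unit_vec j a : le_vec (unit_vec j) a = (0 < a j)%N.
Proof.
apply/le_vecP/idP => [/(_ j)|aj i]; first by rewrite ffunE eqxx.
by rewrite ffunE; case: eqP => [->|].
Qed.

Lemma deg_eq0 x : (deg x == 0)%N = (x == zero_vec).
Proof.
rewrite /deg sum_nat_eq0; apply/forallP/eqP => [x0|-> i]; last by rewrite ffunE.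
by apply/ffunP => i; rewrite ffunE; apply/eqP/x0.
Qed.

Lemma deg_unit_vec j : deg (unit_vec j) = 1%N.
Proof.
rewrite /deg (bigD1 j) //= ffunE eqxx big1 // => i /negbTE ne.
by rewrite ffunE ne.
Qed.

Lemma deg_add_vec x y : deg (add_vec x y) = (deg x + deg y)%N.
Proof. by rewrite /deg -big_split; apply: eq_bigr => i _; rewrite ffunE. Qed.

Section Convolution.
Variable R : comPzRingType.
Implicit Types f g : natvec k -> R.

(** Functions on exponent vectors stand for formal power series in [k] variables:
    [conv] is their product, and [shift j] is multiplication by the [j]-th
    variable. *)
Definition conv f g a : R := \sum_(x <- box a) f x * g (sub_vec a x).

Definition shift j f a : R := if (0 < a j)%N then f (sub_vec a (unit_vec j)) else 0.

Lemma convDl f1 f2 g a : conv (fun x => f1 x + f2 x) g a = conv f1 g a + conv f2 g a.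
Proof. by rewrite -big_split; apply: eq_bigr => x _; rewrite mulrDl. Qed.

Lemma convDr f g1 g2 a : conv f (fun x => g1 x + g2 x) a = conv f g1 a + conv f g2 a.
Proof. by rewrite -big_split; apply: eq_bigr => x _; rewrite mulrDr. Qed.

Lemma conv_suml (I : finType) (c : I -> R) (f : I -> natvec k -> R) g a :
  conv (fun x => \sum_i c i * f i x) g a = \sum_i c i * conv (f i) g a.
Proof.
rewrite /conv (eq_bigr (fun i => \sum_(x <- box a) c i * (f i x * g (sub_vec a x)))).
  by rewrite exchange_big; apply: eq_bigr => x _; rewrite mulr_suml;
    apply: eq_bigr => i _; rewrite mulrA.
by move=> i _; rewrite mulr_sumr.
Qed.

Lemma convZl (c : R) f g a : conv (fun x => c * f x) g a = c * conv f g a.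
Proof. by rewrite /conv mulr_sumr; apply: eq_bigr => x _; rewrite mulrA. Qed.

Lemma conv_sumr (I : finType) (c : I -> R) f (g : I -> natvec k -> R) a :
  conv f (fun x => \sum_i c i * g i x) a = \sum_i c i * conv f (g i) a.
Proof.
rewrite /conv (eq_bigr (fun i => \sum_(x <- box a) c i * (f x * g i (sub_vec a x)))).
  by rewrite exchange_big; apply: eq_bigr => x _; rewrite mulr_sumr;
    apply: eq_bigr => i _; rewrite mulrCA.
by move=> i _; rewrite mulr_sumr.
Qed.

Lemma eq_conv f1 f2 g1 g2 a : f1 =1 f2 -> g1 =1 g2 -> conv f1 g1 a = conv f2 g2 a.
Proof. by move=> ef eg; apply: eq_bigr => x _; rewrite ef eg. Qed.

Lemma conv_shiftl j f g a : conv (shift j f) g a = shift j (conv f g) a.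
Proof.
rewrite /conv /shift.
under eq_bigr do rewrite (fun_if (fun z => z * _)) mul0r.
rewrite -big_mkcond -big_filter /=.
case: ifP => [aj|/negbT aj]; last first.
  rewrite big_filter big1_seq // => x /andP[xj]; rewrite mem_box => /le_vecP /(_ j).
  by move: aj xj; case: (a j) => // _; case: (x j).
have : perm_eq [seq i : natvec k <- box a | 0 < i j]%N
    [seq add_vec y (unit_vec j) | y <- box (sub_vec a (unit_vec j))].
  apply: uniq_perm; first by rewrite filter_uniq ?box_uniq.
    rewrite map_inj_uniq ?box_uniq // => x y.
    by move=> /(congr1 (fun z => sub_vec z (unit_vec j))); rewrite !add_vecK.
  move=> x; rewrite mem_filter mem_box; apply/andP/mapP => [[xj /le_vecP xa]|[y]].
    exists (sub_vec x (unit_vec j)); last by rewrite sub_vecK ?le_unit_vec.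
    by rewrite mem_box; apply/le_vecP => i; rewrite !ffunE leq_sub2r.
  rewrite mem_box => /le_vecP ya ->; split; first by rewrite !ffunE eqxx addn1.
  apply/le_vecP => i; have := ya i; rewrite !ffunE; case: eqP => [->|_] /=; last by lia.
  by lia.
move=> /(perm_big _)->; rewrite big_map; apply: eq_bigr => x _.
rewrite add_vecK; congr (_ * g _); apply/ffunP => i; rewrite !ffunE.
by rewrite subnDA subnAC.
Qed.

Lemma conv_shiftr j f g a : conv f (shift j g) a = shift j (conv f g) a.
Proof.
rewrite /conv /shift.
under eq_bigr do rewrite (fun_if (fun z => _ * z)) mulr0.
rewrite -big_mkcond -big_filter /=.
case: ifP => [aj|/negbT aj]; last first.
  rewrite big_filter big1_seq // => x /andP[]; rewrite ffunE mem_box.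
  by move: aj; case: (a j).
have : perm_eq [seq i <- box a | 0 < sub_vec a i j]%N (box (sub_vec a (unit_vec j))).
  apply: uniq_perm; rewrite ?filter_uniq ?box_uniq //.
  move=> x; rewrite mem_filter !mem_box ffunE; apply/andP/le_vecP => [[xj /le_vecP xa] i|xa].
    by have := xa i; rewrite !ffunE; case: eqP => [->|] /=; lia.
  split; first by have := xa j; rewrite !ffunE eqxx; lia.
  by apply/le_vecP => i; have := xa i; rewrite !ffunE; lia.
move=> /(perm_big _)->; apply: eq_bigr => x _.
by congr (_ * g _); apply/ffunP => i; rewrite !ffunE subnAC.
Qed.

Lemma conv0f g a : conv (fun x => (x == zero_vec)%:R) g a = g a.
Proof.
rewrite /conv (bigD1_seq zero_vec) ?box_uniq ?mem_box //=; last first.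
  by apply/le_vecP => i; rewrite ffunE.
rewrite eqxx mul1r big1 ?addr0 => [|x /negbTE->]; last by rewrite mul0r.
by congr g; apply/ffunP => i; rewrite !ffunE subn0.
Qed.

End Convolution.
End Exponents.

Section ElementarySums.
Variables (R : numFieldType) (V : finType) (k : nat) (F : nat -> V -> R).
Hypothesis F0 : forall v, F 0 v = 1.
Implicit Types (a b x y : natvec k) (j : 'I_k) (A : {set V}) (m : {ffun V -> 'I_k.+1}).

(** How many vertices take each positive value.  The variable [t_i] of the
    generating function is the one of index [i - 1] in ['I_k]. *)
Definition profile m : natvec k := [ffun j : 'I_k => #|[set v | m v == j.+1 :> nat]|].

(** The coefficient of [t^a] in [\prod_(v in A) (1 + \sum_i t_i F i v)]; a vertex at
    which [m] is 0 chooses the term 1 of its factor. *)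
Definition elem_sum A a : R :=
  \sum_(m : {ffun V -> 'I_k.+1} | [forall v, (v \in A) || (m v == ord0)] && (profile m == a))
    \prod_v F (m v) v.

Definition monomial x v : R := \prod_(j < k) F j.+1 v ^+ x j.

(** For [x] nonzero, the coefficient of [u^x] in [log (1 + \sum_i u_i)]. *)
Definition log_coef x : R :=
  (-1) ^+ (deg x).-1 * (deg x).-1`!%:R / (\prod_(j < k) (x j)`!)%N%:R.

(** For [x] nonzero, the coefficient of [t^x] in
    [\sum_(v in A) log (1 + \sum_i t_i F i v)]. *)
Definition cumulant A x : R := log_coef x * \sum_(v in A) monomial x v.

Lemma elem_sum0 a : elem_sum set0 a = (a == zero_vec k)%:R.
Proof.
pose m0 : {ffun V -> 'I_k.+1} := [ffun=> ord0].
have P0 m : [forall v, (v \in set0) || (m v == ord0)] = (m == m0).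
  apply/forallP/eqP => [mv|-> v]; last by rewrite ffunE eqxx orbT.
  by apply/ffunP => v; rewrite ffunE; have := mv v; rewrite inE => /eqP.
have pm0 : profile m0 = zero_vec k.
  apply/ffunP => j; rewrite !ffunE; apply: eq_card0 => v.
  by rewrite !inE ffunE.
rewrite /elem_sum; under eq_bigl do rewrite P0.
rewrite big_mkcondr big_pred1_eq pm0 eq_sym.
case: eqP => // _; apply: big1 => v _; by rewrite ffunE F0.
Qed.

(** Multiplication by the factor [1 + \sum_j t_j F j v]: the new vertex [v] takes
    either the value 0 or one of the values [j.+1]. *)
Lemma elem_sumU1 A v a : v \notin A ->
  elem_sum (v |: A) a = elem_sum A a + \sum_(j < k) F j.+1 v * shift j (elem_sum A) a.
Proof.
move=> vA; rewrite /elem_sum (partition_big (fun m => m v) predT) //= big_ord_recl.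
congr (_ + _).
  apply: eq_bigl => m; rewrite andbAC; congr (_ && _).
  apply/andP/forallP => [[/forallP mA mv] w|mA]; last split.
  - by have := mA w; rewrite !inE; case: (eqVneq w v) => [->|] //=; rewrite mv orbT.
  - by apply/forallP => w; have := mA w; rewrite !inE -orbA => ->; rewrite orbT.
  - by have := mA v; rewrite (negbTE vA).
apply: eq_bigr => j _; rewrite /shift.
pose h m : {ffun V -> 'I_k.+1} := [ffun w => if w == v then lift ord0 j else m w].
pose h' m : {ffun V -> 'I_k.+1} := [ffun w => if w == v then ord0 else m w].
rewrite (reindex_onto h h') /=; last first.
  move=> m /andP[_ /eqP mv]; apply/ffunP => w; rewrite !ffunE.
  by case: eqP => [->|].
have hh m : (h' (h m) == m) = (m v == ord0).
  apply/eqP/eqP => [<-|mv]; first by rewrite !ffunE eqxx.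
  by apply/ffunP => w; rewrite !ffunE; case: eqP => [->|].
have hv m : h m v = lift ord0 j by rewrite ffunE eqxx.
have hprof m : m v = ord0 -> profile (h m) = add_vec (profile m) (unit_vec j).
  move=> mv; apply/ffunP => i; rewrite !ffunE (cardsD1 v) inE hv addnC.
  congr (_ + _)%N; last first.
    by rewrite /= eqSS eq_sym.
  apply: eq_card => w; rewrite !inE ffunE.
  by case: (eqVneq w v) => [->|] //=; rewrite mv.
have hsupp m : [forall w, (w \in v |: A) || (h m w == ord0)] && (m v == ord0)
   = [forall w, (w \in A) || (m w == ord0)].
  apply/andP/forallP => [[/forallP mA mv] w|mA]; last split.
  - by have := mA w; rewrite !inE ffunE; case: (eqVneq w v) => [->|] //=; rewrite mv orbT.
  - apply/forallP => w; have := mA w; rewrite !inE ffunE.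
    by case: (eqVneq w v).
  - by have := mA v; rewrite (negbTE vA).
have hprod m : m v = ord0 -> \prod_w F (h m w) w = F j.+1 v * \prod_w F (m w) w.
  move=> mv; rewrite (bigD1 v) //= [in RHS](bigD1 v) //= hv mv F0 mul1r; congr (_ * _).
  by apply: eq_bigr => w /negbTE ne; rewrite ffunE ne.
case: ifP => [aj|/negbT aj].
  rewrite mulr_sumr; apply: eq_big => m.
    rewrite hv eqxx andbT hh andbAC hsupp; apply: andb_id2l => /forallP mA.
    have /eqP mv : m v == ord0 by have := mA v; rewrite (negbTE vA).
    rewrite hprof //; apply/eqP/eqP => [<-|->]; first by rewrite add_vecK.
    by rewrite sub_vecK ?le_unit_vec.
  by rewrite hh => /andP[_ /eqP mv]; rewrite hprod.
rewrite mulr0; apply: big_pred0 => m; apply/negbTE/negP; rewrite hh.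
move=> /andP[/andP[/andP[_ /eqP ma] _] /eqP mv]; move: aj; rewrite -ma hprof //.
by rewrite !ffunE eqxx addn1.
Qed.

(** With L = \sum_j t_j F j v, this is (t_i d/dt_i log (1 + L)) (1 + L) = t_i F i v.
    At an exponent of degree at least 2 the left side vanishes because
    \sum_j (x_i - [i = j]) x_j = x_i (|x| - 1). *)
Lemma log_derivative i v x :
  (x i)%:R * (log_coef x * monomial x v)
   + \sum_(j < k) F j.+1 v * shift j (fun y => (y i)%:R * (log_coef y * monomial y v)) x
  = F i.+1 v * shift i (fun y => (y == zero_vec k)%:R) x.
Proof.
have shiftE j : F j.+1 v * shift j (fun y => (y i)%:R * (log_coef y * monomial y v)) x
   = ((x i - (i == j))%N * x j)%:R * ((-1) ^+ (deg x).-2 * (deg x).-2`!%:R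
       / (\prod_(j < k) (x j)`!)%N%:R * monomial x v).
  rewrite /shift; case: posnP => [->|xj]; first by rewrite muln0 mul0r mulr0.
  set y := sub_vec x _.
  have xE : x = add_vec y (unit_vec j) by rewrite sub_vecK ?le_unit_vec.
  have degx : deg x = (deg y).+1 by rewrite xE deg_add_vec deg_unit_vec addn1.
  have monx : monomial x v = F j.+1 v * monomial y v.
    rewrite /monomial (bigD1 j) //= [in RHS](bigD1 j) //= mulrA -exprS; congr (_ * _).
      by rewrite !ffunE eqxx subn1 prednK.
    by apply: eq_bigr => l /negbTE ne; rewrite !ffunE ne subn0.
  have facx : (\prod_(j < k) (x j)`! = x j * \prod_(j < k) (y j)`!)%N.
    rewrite (bigD1 j) //= [in RHS](bigD1 j) //= mulnA; congr (_ * _)%N.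
      by rewrite !ffunE eqxx subn1 -[in LHS](prednK xj) factS prednK.
    by apply: eq_bigr => l /negbTE ne; rewrite !ffunE ne subn0.
  have -> : (y i = x i - (i == j))%N by rewrite !ffunE.
  rewrite monx facx /log_coef degx /= !natrM.
  have xj0 : (x j)%:R != 0 :> R by rewrite pnatr_eq0 -lt0n.
  have P0 : (\prod_(j < k) (y j)`!)%N%:R != 0 :> R.
    by rewrite pnatr_eq0 -lt0n prodn_gt0 // => l; rewrite fact_gt0.
  move: xj0 P0; set P := (\prod_(j < k) _)%N%:R; move: P (x j)%:R => P X X0 P0.
  by field; rewrite X0 P0.
under eq_bigr do rewrite shiftE.
rewrite -mulr_suml -natr_sum.
have -> : (\sum_(j < k) (x i - (i == j)) * x j = x i * (deg x).-1)%N.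
  have [xi0|xi] := posnP (x i).
    by rewrite xi0 mul0n big1 // => j _; rewrite sub0n mul0n.
  rewrite /deg (bigD1 i) //= [in RHS](bigD1 i) //= eqxx.
  rewrite -subn1 -addnBAC // mulnDr mulnC; congr (_ + _)%N.
  rewrite big_distrr /=; apply: eq_bigr => j /negbTE ne.
  by rewrite eq_sym ne subn0.
rewrite /log_coef /shift.
case: posnP => [xi0|xi]; first by rewrite xi0 mul0n !mul0r addr0 mulr0.
case degx : (deg x) => [|[|n]].
- by move: degx => /eqP; rewrite deg_eq0 => /eqP x0; rewrite x0 ffunE in xi.
- have xE : x = unit_vec i.
    apply/esym/ffunP => j; rewrite ffunE; move: degx; rewrite /deg (bigD1 i) //=.
    case: eqP => [->|/eqP ne]; first by lia.
    by rewrite (bigD1 j) //=; lia.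
  rewrite muln0 mul0r addr0 xE.
  have -> : sub_vec (unit_vec i) (unit_vec i) = zero_vec k.
    by apply/ffunP => j; rewrite !ffunE subnn.
  rewrite eqxx /monomial big1 => [|j _]; last by rewrite ffunE; case: eqP.
  rewrite (bigD1 i) //= ffunE eqxx expr1 big1 => [|j /negbTE ne]; last by rewrite ffunE ne.
  by rewrite /= !mulr1 !mul1r invr1 mul1r.
- have -> : (sub_vec x (unit_vec i) == zero_vec k) = false.
    apply/negbTE; rewrite -deg_eq0; move: degx.
    rewrite -{1}(@sub_vecK _ x (unit_vec i)) ?le_unit_vec //.
    by rewrite deg_add_vec deg_unit_vec; lia.
  rewrite /= factS !natrM exprS; ring.
Qed.

(** Writing E and C for the series of coefficients [elem_sum A] and [cumulant A],
    this is t_i dE/dt_i = (t_i dC/dt_i) E.  When a vertex [v] is added, E is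
    multiplied by 1 + L and C gains log (1 + L); the product rule reduces the
    equation to the one for E and to [log_derivative]. *)
Lemma elem_sum_newton A a i :
  (a i)%:R * elem_sum A a = conv (fun x => (x i)%:R * cumulant A x) (elem_sum A) a.
Proof.
elim: {A}_.+1 {-2}A (ltnSn #|A|) a => // N IH A leAN a.
have [->|[v vA]] := set_0Vmem A.
  rewrite elem_sum0 /conv big1 => [|x _]; last by rewrite /cumulant big_set0 !mulr0 mul0r.
  by case: eqP => [->|_]; rewrite ?ffunE ?mul0r // mulr0.
rewrite -(setD1K vA); set B := A :\ v.
have vB : v \notin B by rewrite !inE eqxx.
have {}IH b : (b i)%:R * elem_sum B b = conv (fun x => (x i)%:R * cumulant B x) (elem_sum B) b.
  by apply: IH; move: leAN; rewrite (cardsD1 v) vA.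
set e := elem_sum B in IH *; set c := fun x => (x i)%:R * cumulant B x in IH.
pose u x := (x i)%:R * (log_coef x * monomial x v).
pose e' a := \sum_(j < k) F j.+1 v * shift j e a.
have eE : elem_sum (v |: B) =1 (fun a => e a + e' a) by move=> b; exact: elem_sumU1.
rewrite (@eq_conv _ _ _ (fun x => c x + u x) _ (fun a => e a + e' a)) //; last first.
  by move=> x; rewrite /c /u /cumulant big_setU1 //= !mulrDr addrC.
rewrite eE convDl !convDr -IH mulrDr -!addrA; congr (_ + _).
(* The product rule for multiplication by L = \sum_j t_j F j v. *)
have -> : (a i)%:R * e' a = conv c e' a + F i.+1 v * shift i e a.
  rewrite /e' conv_sumr mulr_sumr (bigD1 i) //= [in RHS](bigD1 i) //= addrAC -mulrDr.
  have sh j : conv c (shift j e) a = shift j (fun b => (b i)%:R * e b) a.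
    by rewrite conv_shiftr /shift; case: ifP => // _; rewrite IH.
  congr (_ + _).
    rewrite sh mulrCA; congr (_ * _); rewrite /shift; case: ifP => ai; last by rewrite mulr0 addr0.
    rewrite !ffunE eqxx -[in LHS](subnK ai) natrD mulrDl mul1r.
    by [].
  apply: eq_bigr => j /negbTE ne; rewrite sh mulrCA; congr (_ * _).
  rewrite /shift; case: ifP => aj; last by rewrite mulr0.
  by rewrite !ffunE eq_sym ne subn0.
congr (_ + _).
(* What is left is t_i (dL/dt_i) E = (t_i d/dt_i log (1 + L)) (1 + L) E. *)
rewrite conv_sumr; under eq_bigr do rewrite conv_shiftr -conv_shiftl.
rewrite -conv_suml -convDl.
rewrite (@eq_conv _ _ _ (fun x => F i.+1 v * shift i (fun y => (y == zero_vec k)%:R) x) _ e) //.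
  by rewrite convZl conv_shiftl /shift; case: ifP => // _; rewrite conv0f.
by move=> x; rewrite -log_derivative.
Qed.

End ElementarySums.

(** * Coefficients of an exponential, as sums over [Rset] *)

Lemma fsbig_setT_seq (R : Type) (idx : R) (op : Monoid.com_law idx) (T : choiceType)
    (s : seq T) (F : T -> R) :
  uniq s -> (forall x, x \notin s -> F x = idx) ->
  \big[op/idx]_(x \in [set: T]%classic) F x = \big[op/idx]_(x <- s) F x.
Proof.
move=> us Fs; rewrite [RHS]fsbig_seq //; apply/esym; apply: fsbig_widen => // x [_ /= xs].
by rewrite Fs //; apply/negP.
Qed.

Arguments fsbig_setT_seq {R idx op T s F}.

Lemma nat_sum_to_ge (T : choiceType) (F : T -> nat) s x : nat_sum_to F s -> (F x <= s)%N.
Proof.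
move=> [fin <-]; case: (posnP (F x)) => [-> //|Fx].
rewrite -(fsbig_widen [set x | F x != 0%N]%classic) // => [|y [_ /= /negP]]; last first.
  by rewrite negbK => /eqP.
rewrite fsbig_finite //= (big_rem x) ?leq_addr //=.
by rewrite in_fset_set //; apply: mem_set; rewrite /= -lt0n.
Qed.

Section Cycles.
Variables (R : numFieldType) (k : nat).
Implicit Types (a b x y : natvec k) (alpha beta : natvec k -> nat).

(** All the infinite sums in [Rset] live on one finite box, and any box that
    contains [a] will do: functions of [Rset (sub_vec a x)] and of [Rset a] can then
    be compared by sums with the same range. *)
Lemma RsetP b a alpha : le_vec a b ->
  Rset a alpha <-> [/\ alpha (zero_vec k) = 0%N,
    forall y, y \notin box b -> alpha y = 0%N &
    forall i, (\sum_(y <- box b) y i * alpha y)%N = a i].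
Proof.
move=> /le_vecP ab; split=> [[a0 asum]|[a0 asupp asum]].
  have asupp y : y \notin box b -> alpha y = 0%N.
    move=> yb; apply/eqP; apply: contraNT yb; rewrite -lt0n => ay.
    rewrite mem_box; apply/le_vecP => i; apply: leq_trans (ab i).
    exact: leq_trans (leq_pmulr _ ay) (nat_sum_to_ge y (asum i)).
  split=> // i; have [_ <-] := asum i; rewrite (fsbig_setT_seq (box_uniq b)) //.
  by move=> y /asupp->; rewrite muln0.
split=> // i; split; last first.
  rewrite -asum (fsbig_setT_seq (box_uniq b)) // => y /asupp->.
  by rewrite muln0.
apply: (@sub_finite_set _ _ [set` box b]%classic) => [y /=|]; last exact: finite_seq.
by apply: contraNT => /asupp->; rewrite muln0.
Qed.

Lemma le_vec_refl a : le_vec a a.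
Proof. by apply/le_vecP. Qed.

Lemma Rset_le a alpha y : Rset a alpha -> (alpha y <= deg a)%N.
Proof.
move=> [a0 asum]; have [->|yN0] := eqVneq y (zero_vec k); first by rewrite a0.
have [i yi] : exists i, (0 < y i)%N.
  apply/existsP; apply: contraNT yN0; rewrite negb_exists => /forallP y0.
  by apply/eqP/ffunP => i; rewrite ffunE; apply/eqP; rewrite -leqn0 leqNgt.
apply: leq_trans (leq_pmull _ yi) _; apply: leq_trans (nat_sum_to_ge y (asum i)) _.
by rewrite /deg (bigD1 i) //= leq_addr.
Qed.

Lemma finite_Rset a : finite_set (Rset a).
Proof.
pose ext (g : {ffun seq_sub (box a) -> 'I_(deg a).+1}) y : nat :=
  if insub y is Some z then g z : nat else 0%N.
apply: (@sub_finite_set _ _ [set ext g | g in [set: {ffun seq_sub (box a) -> 'I_(deg a).+1}]]%classic).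
  move=> alpha Ra; exists [ffun z => inord (alpha (val z))] => //=.
  apply/funext => y; rewrite /ext; case: insubP => [z _ <-|yb].
    by rewrite ffunE inordK // ltnS Rset_le.
  by have [_ ->] := (RsetP alpha (le_vec_refl a)).1 Ra.
by apply: finite_image; apply: finite_finset.
Qed.

Variable w : natvec k -> R.

Definition weight alpha : R :=
  \big[*%R/1]_(y \in [set: natvec k]%classic) (w y ^+ alpha y / (alpha y)`!%:R).

(** The coefficient of [t^a] in [exp (\sum_x w x t^x)], where [x] ranges over the
    nonzero exponents and each factor [exp (w x t^x)] is expanded separately. *)
Definition exp_sum a : R := \sum_(alpha \in Rset a) weight alpha.

Definition incr_at x alpha : natvec k -> nat := fun y => (alpha y + (y == x))%N.

(** [n * (w^n / n!) = w * (w^(n-1) / (n-1)!)], with the other factors unchanged. *)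
Lemma weight_incr_at a x alpha : (forall y, y \notin box a -> alpha y = 0%N) -> x \in box a ->
  (incr_at x alpha x)%:R * weight (incr_at x alpha) = w x * weight alpha.
Proof.
move=> asupp xa; rewrite /weight !(fsbig_setT_seq (box_uniq a)); last first.
- move=> y ya; rewrite /incr_at asupp //; case: eqP => [yx|_]; first by rewrite yx xa in ya.
  by rewrite expr0 fact0 divr1.
- by move=> y /asupp->; rewrite expr0 fact0 divr1.
rewrite !(bigD1_seq x) ?box_uniq //= mulrA [RHS]mulrA; congr (_ * _); last first.
  by apply: eq_bigr => y /negbTE ne; rewrite /incr_at ne addn0.
rewrite /incr_at eqxx addn1 factS natrM exprS.
have f0 : (alpha x)`!%:R != 0 :> R by rewrite pnatr_eq0 -lt0n fact_gt0.
have a0 : (alpha x).+1%:R != 0 :> R by rewrite pnatr_eq0.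
by move: f0 a0; move: (_`!%:R) (_.+1%:R) (_ ^+ _) => P X Y P0 X0; field; rewrite X0 P0.
Qed.

(** Removing one occurrence of [x] is a bijection from the [alpha] in [Rset a] with
    [alpha x] positive onto [Rset (sub_vec a x)]. *)
Lemma exp_sum_marked a x : x != zero_vec k -> x \in box a ->
  \sum_(alpha \in Rset a) ((alpha x)%:R * weight alpha) = w x * exp_sum (sub_vec a x).
Proof.
move=> x0 xa; have lexa : le_vec x a by rewrite -mem_box.
have lesub : le_vec (sub_vec a x) a.
  by apply/le_vecP => i; rewrite ffunE leq_subr.
rewrite -(fsbig_widen [set alpha | Rset a alpha /\ (0 < alpha x)%N]%classic); last 2 first.
- by move=> alpha [].
- move=> alpha [Ra /= nR]; rewrite (_ : alpha x = 0%N) ?mul0r //.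
  by apply/eqP; rewrite -leqn0 leqNgt; apply/negP => ax; apply: nR.
rewrite (reindex_fsbig (incr_at x) (Rset (sub_vec a x))); last first.
  split.
  - move=> beta /(RsetP beta lesub)[b0 bsupp bsum]; split; last by rewrite /incr_at eqxx addn1.
    apply/(RsetP _ (le_vec_refl a)); split.
    + by rewrite /incr_at b0 eq_sym (negbTE x0).
    + move=> y ya; rewrite /incr_at bsupp //; case: eqP => // yx; by rewrite yx xa in ya.
    + move=> i; under eq_bigr do rewrite /incr_at mulnDr.
      rewrite big_split /= bsum ffunE (bigD1_seq x) ?box_uniq //= eqxx muln1.
      rewrite big1 => [|y /negbTE->]; last by rewrite muln0.
      by rewrite addn0 subnK //; have /le_vecP := lexa.
  - move=> b1 b2 _ _ /(congr1 (fun f y => f y - (y == x))%N) eqb.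
    apply/funext => y; have := congr1 (fun f => f y) eqb.
    by rewrite /incr_at !addnK.
  - move=> alpha [/(RsetP alpha (le_vec_refl a))[a0 asupp asum] ax].
    exists (fun y => alpha y - (y == x))%N; last first.
      apply/funext => y; rewrite /incr_at subnK //.
      by case: eqP => [->|].
    apply/(RsetP _ lesub); split.
    + by rewrite a0.
    + by move=> y /asupp ->.
    + move=> i; rewrite ffunE -asum (bigD1_seq x) ?box_uniq //= [in RHS](bigD1_seq x) ?box_uniq //=.
      rewrite eqxx mulnBr muln1 addnBAC ?leq_pmulr //; congr (_ + _ - _)%N.
      by apply: eq_bigr => y /negbTE ->; rewrite subn0.
rewrite mulr_fsumr; apply: eq_fsbigr => beta /set_mem /(RsetP beta lesub)[_ bsupp _].
exact: (weight_incr_at bsupp xa).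
Qed.

(** Weigh each [alpha] by [a_i = \sum_x x_i alpha x] and exchange the two sums. *)
Lemma exp_sum_newton a i :
  (a i)%:R * exp_sum a = conv (fun x => (x i)%:R * w x) exp_sum a.
Proof.
rewrite mulr_fsumr.
rewrite (eq_fsbigr (fun alpha => \sum_(x <- box a) (x i)%:R * ((alpha x)%:R * weight alpha))); last first.
  move=> alpha /set_mem /(RsetP alpha (le_vec_refl a))[_ _ /(_ i)<-].
  by rewrite natr_sum mulr_suml; apply: eq_bigr => x _; rewrite natrM mulrA.
rewrite (@fsbig_finite _ _ _ _ (Rset a) _ (finite_Rset a)) exchange_big /=.
rewrite /conv big_seq [RHS]big_seq; apply: eq_bigr => x xa.
rewrite -mulr_sumr -(@fsbig_finite _ _ _ _ (Rset a) _ (finite_Rset a)).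
have [->|x0] := eqVneq x (zero_vec k); first by rewrite ffunE !mul0r.
by rewrite exp_sum_marked // mulrA.
Qed.

Lemma exp_sum0 : exp_sum (zero_vec k) = 1.
Proof.
rewrite /exp_sum; have -> : Rset (zero_vec k) = [set (fun=> 0%N)]%classic.
  apply/seteqP; split=> [alpha Ra|alpha ->] /=.
    apply/funext => y; apply/eqP; rewrite -leqn0.
    by apply: leq_trans (Rset_le y Ra) _; rewrite leqn0 deg_eq0.
  apply/(RsetP _ (le_vec_refl _)); split=> // i.
  by rewrite ffunE big1 // => y _; rewrite muln0.
by rewrite fsbig_set1 /weight fsbig1 // => y _; rewrite expr0 fact0 divr1.
Qed.

(** Some [a_i] is positive unless [a] is zero, and only the terms with [x_i] positive
    contribute to the right side: these involve exponents of smaller degree. *)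
Lemma newton_unique (c f g : natvec k -> R) :
  f (zero_vec k) = g (zero_vec k) ->
  (forall a i, (a i)%:R * f a = conv (fun x => (x i)%:R * c x) f a) ->
  (forall a i, (a i)%:R * g a = conv (fun x => (x i)%:R * c x) g a) ->
  f =1 g.
Proof.
move=> fg0 fN gN a; elim: {a}_.+1 {-2}a (ltnSn (deg a)) => // n IH a dega.
have [->//|aN0] := eqVneq a (zero_vec k).
have [i ai] : exists i, (0 < a i)%N.
  apply/existsP; apply: contraNT aN0; rewrite negb_exists => /forallP a0.
  by apply/eqP/ffunP => i; rewrite ffunE; apply/eqP; rewrite -leqn0 leqNgt.
have ai0 : (a i)%:R != 0 :> R by rewrite pnatr_eq0 -lt0n.
apply: (mulfI ai0); rewrite fN gN; rewrite /conv big_seq [RHS]big_seq.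
apply: eq_bigr => x; rewrite mem_box => xa.
have [->|xi] := posnP (x i); first by rewrite !mul0r.
congr (_ * _); apply: IH; rewrite ltnS in dega; apply: leq_trans dega.
rewrite -{2}(sub_vecK xa) deg_add_vec.
by rewrite -[X in (X < _)%N]addn0 ltn_add2l /deg (bigD1 i) //= addn_gt0 xi.
Qed.

End Cycles.

(** The multivariate form of the identity which expresses elementary symmetric
    functions by power sums. *)
Lemma elem_sum_exp (R : numFieldType) (V : finType) (k : nat) (F : nat -> V -> R) :
  (forall v, F 0%N v = 1) ->
  forall a : natvec k, elem_sum F [set: V]%SET a = exp_sum (cumulant F [set: V]%SET) a.
Proof.
move=> F0; apply: (@newton_unique _ _ (cumulant F [set: V]%SET)).
- rewrite exp_sum0 /elem_sum (bigD1 [ffun=> ord0]) /=; last first.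
    apply/andP; split; first by apply/forallP => v; rewrite inE.
    by apply/eqP/ffunP => j; rewrite !ffunE; apply: eq_card0 => v; rewrite !inE ffunE.
  rewrite [X in X + _]big1 => [|v _]; last by rewrite ffunE F0.
  rewrite [X in _ + X]big1 ?addr0 // => m.
  move=> /andP[/andP[_ /eqP/ffunP m0] /eqP[]]; apply/ffunP => v; rewrite ffunE.
  case: (unliftP ord0 (m v)) => [j mv|//].
  have := m0 j; rewrite !ffunE => /eqP; rewrite cards_eq0 => /eqP/setP/(_ v).
  by rewrite !inE mv /= eqxx.
- by move=> a i; apply: elem_sum_newton.
- by move=> a i; apply: exp_sum_newton.
Qed.

(** * The sums of the formula as sums over multiplicity functions *)

Lemma mul_card_unif_mean (R : archiRealFieldType) (T : finType) (X : T -> R) :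
  #|T|%:R * unif_mean [set: T]%SET X = \sum_t X t.
Proof.
rewrite /unif_mean cardsT (eq_bigl predT) => [|t]; last by rewrite inE.
have [T0|T0] := posnP #|T|; last by rewrite mulrC divfK // pnatr_eq0 -lt0n.
by rewrite T0 mul0r big1 // => t; have := card0_eq T0 t; rewrite !inE.
Qed.

Section SideSum.
Variables (R : archiRealFieldType) (V : finType) (d : V -> nat) (k : nat).

Definition falling (i : nat) (v : V) : R := ((d v) ^_ (2 * i))%:R.

(** Multiplied by the number of vertices, the moment is a power sum. *)
Lemma falling_momentE (y : natvec k) :
  #|V|%:R * falling_moment R d y = \sum_(v in [set: V]%SET) monomial falling y v.
Proof.
have mE v : \prod_(i < k) ((2 * i.+1 <= d v)%N%:R *
     ((d v)`!%:R / (d v - 2 * i.+1)`!%:R)) ^+ y i = monomial falling y v :> R.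
  apply: eq_bigr => i _; congr (_ ^+ _); rewrite /falling.
  case: (leqP (2 * i.+1) (d v)) => le; last by rewrite ffact_small // mul0r.
  by rewrite mul1r -(ffact_fact le) natrM mulfK // pnatr_eq0 -lt0n fact_gt0.
rewrite /falling_moment mul_card_unif_mean (eq_bigr _ (fun v _ => mE v)).
by apply: eq_bigl => v; rewrite inE.
Qed.

(** Distributing the sign over [y] turns each factor into a power of a cumulant. *)
Lemma side_termE (a : natvec k) (alpha : natvec k -> nat) : Rset a alpha ->
  (-1) ^+ (\big[addn/0%N]_(x \in [set: natvec k]%classic)
             ((\sum_(i < k) x i).-1 * alpha x)%N) *
    \big[*%R/1]_(y \in [set: natvec k]%classic) side_factor R d alpha y
  = weight (cumulant falling [set: V]%SET) alpha.
Proof.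
move=> /(RsetP alpha (le_vec_refl a))[_ asupp _].
rewrite /weight !(fsbig_setT_seq (box_uniq a)); first last.
- by move=> y /asupp->; rewrite muln0.
- by move=> y ya; rewrite /side_factor asupp // expr0 fact0 invr1 mulr1.
- by move=> y /asupp->; rewrite expr0 fact0 divr1.
rewrite (big_morph (fun n => (-1) ^+ n : R) (id1 := 1) (op1 := *%R)); last 2 first.
- by move=> m n; rewrite exprD.
- by rewrite expr0.
rewrite -big_split; apply: eq_bigr => y _ /=.
rewrite /side_factor /cumulant /log_coef falling_momentE exprM mulrCA mulrC; congr (_ / _).
rewrite -exprMn; congr (_ ^+ _); rewrite -/(deg y) -!mulrA; congr (_ * _).
by rewrite mulrC -!mulrA mulrCA.
Qed.

(** The sum over [a] only sorts the functions [m] by their profile: the weight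
    [\prod_j (j!)^(2 a_j)] in the denominator is [\prod_v ((m v)!)^2]. *)
Lemma side_sumE : side_sum R d k = k`!%:R ^+ 2 *
  (\sum_(m : {ffun V -> 'I_k.+1} | \sum_v m v == k)
      \prod_v ('C(d v, 2 * m v) * 'C(2 * m v, m v)))%N%:R.
Proof.
(* Each entry of an [a] with \sum_i i a_i = k is at most [k]. *)
pose bound : natvec k := [ffun=> k].
pose s : seq (natvec k) := [seq a : natvec k <- box bound | (\sum_(i < k) i.+1 * a i)%N == k].
have us : uniq s by rewrite filter_uniq ?box_uniq.
have sP (a : natvec k) : (a \in s) = ((\sum_(i < k) i.+1 * a i)%N == k).
  rewrite mem_filter andb_idr // => /eqP ak; rewrite mem_box; apply/le_vecP => i.
  rewrite ffunE -[leqRHS]ak (bigD1 i) //=; apply: leq_trans (leq_addr _ _).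
  exact: leq_pmull.
rewrite /side_sum (_ : [set a | _]%classic = [set` s]%classic); last first.
  by apply/seteqP; split=> a /=; rewrite sP => /eqP.
rewrite -fsbig_seq //.
have partV (T : Type) (idx : T) (op : Monoid.com_law idx) (m : {ffun V -> 'I_k.+1}) (f : nat -> T) :
    f 0%N = idx -> \big[op/idx]_v f (m v) =
    \big[op/idx]_(j < k) iterop (profile m j) op (f j.+1) idx.
  move=> f0; rewrite (partition_big m predT) //= big_ord_recl.
  rewrite big1 ?Monoid.mul1m => [|v /eqP->//].
  apply: eq_bigr => j _; rewrite (eq_bigr (fun=> f j.+1)) => [|v /eqP->//].
  rewrite big_const ffunE -Monoid.iteropE; congr iterop.
  by apply: eq_card => v; rewrite !inE.
rewrite natr_sum mulr_sumr.
transitivity (\sum_(a <- s) \sum_(m : {ffun V -> 'I_k.+1} | profile m == a)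
  (k`!%:R ^+ 2 / \prod_(j < k) (j.+1)`!%:R ^+ (2 * a j) * \prod_v falling (m v) v)).
  apply: eq_bigr => a _; rewrite -mulr_sumr; congr (_ * _).
  rewrite (eq_fsbigr (weight (cumulant falling [set: V]%SET))); last first.
    by move=> alpha /set_mem Ra; rewrite (side_termE Ra).
  rewrite -/(exp_sum _ a) -elem_sum_exp => [|v]; last by rewrite /falling muln0 ffactn0.
  apply: eq_bigl => m; rewrite (_ : [forall v, _]) //.
  by apply/forallP => v; rewrite inE.
under eq_bigr do rewrite big_mkcond.
rewrite exchange_big /= [RHS]big_mkcond; apply: eq_bigr => m _.
have -> : (\sum_v m v = \sum_(j < k) j.+1 * profile m j)%N.
  rewrite (@partV _ 0%N addn m id) //; apply: eq_bigr => j _.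
  by rewrite Monoid.iteropE iter_addn addn0.
rewrite -sP -big_mkcond /=; case: ifP => ms; last first.
  rewrite big1_seq // => a /andP[/eqP<-]; by rewrite ms.
under eq_bigl do rewrite eq_sym.
rewrite -big_filter filter_pred1_uniq // big_seq1 -mulrA; congr (_ * _).
have -> : \prod_(j < k) (j.+1)`!%:R ^+ (2 * profile m j) = \prod_v (m v)`!%:R ^+ 2 :> R.
  rewrite (@partV _ 1 *%R m (fun i => i`!%:R ^+ 2 : R)) ?expr1n //; apply: eq_bigr => j _.
  by rewrite exprM.
rewrite natr_prod -prodfV -big_split; apply: eq_bigr => v _ /=.
rewrite /falling -bin_ffact.
have le : (m v <= 2 * m v)%N by rewrite mul2n -addnn leq_addr.
rewrite -(bin_fact le) (_ : 2 * m v - m v = m v)%N; last by rewrite mul2n -addnn addnK.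
have f0 : (m v)`!%:R != 0 :> R by rewrite pnatr_eq0 -lt0n fact_gt0.
by rewrite !natrM; move: f0; set f := _`!%:R => f0; field.
Qed.

End SideSum.

(** * The expected number of multi-hyperedge pairs *)

Lemma fact_real_nat (R : archiRealFieldType) n : fact_real (n%:R : R) = n`!%:R.
Proof. by rewrite /fact_real natrK. Qed.

(** An unordered pair [{a, b}] comes from exactly two ordered pairs. *)
Lemma double_num_multi_pairs (V E : finType) (dout din : V -> nat)
    (H : dihypergraph E dout din) :
  ((num_multi_pairs H).*2 = \sum_e \sum_(e' | e' != e) same_hyperedge H e e')%N.
Proof.
have sameC e e' : same_hyperedge H e e' = same_hyperedge H e' e.
  by rewrite /same_hyperedge eq_sym [X in _ && X]eq_sym.
pose D := [set p : E * E | (p.2 != p.1) && same_hyperedge H p.1 p.2].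
have -> : (\sum_e \sum_(e' | e' != e) same_hyperedge H e e' = #|D|)%N.
  rewrite pair_big_dep /= -sum1_card; under [RHS]eq_bigl do rewrite inE.
  rewrite big_mkcondr; apply: eq_bigr => p _; by case: same_hyperedge.
rewrite -sum1_card (partition_big (fun p : E * E => [set p.1; p.2])
  (fun P => [exists e1, exists e2, [&& e1 != e2, P == [set e1; e2] & same_hyperedge H e1 e2]])) /=; last first.
  move=> [e1 e2]; rewrite inE /= => /andP[ne same].
  by apply/existsP; exists e1; apply/existsP; exists e2; rewrite eq_sym ne eqxx.
rewrite (eq_bigr (fun=> 2%N)); last first.
  move=> P /existsP[a /existsP[b /and3P[ab /eqP-> same]]].
  have <- : #|[set (a, b); (b, a)]| = 2%N by rewrite cards2 xpair_eqE negb_and ab.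
  rewrite sum1_card; apply: eq_card => -[x y]; rewrite unfold_in /= !inE /= !xpair_eqE.
  apply/andP/orP => [[/andP[yx _] /eqP xy]|].
    have xin : x \in [set a; b] by rewrite -xy !inE eqxx.
    have yin : y \in [set a; b] by rewrite -xy !inE eqxx orbT.
    move: xin yin yx; rewrite !inE => /orP[]/eqP-> /orP[]/eqP->; rewrite ?eqxx //.
      by left.
    by right.
  move=> [|] /andP[/eqP-> /eqP->]; first by rewrite eq_sym ab same.
  by rewrite ab sameC same setUC.
rewrite sum_nat_const muln2; congr (_.*2); rewrite /num_multi_pairs.
by apply: eq_card => P; rewrite inE.
Qed.

(** The factorials of the other hyperedges cancel between the number of balanced
    assignments and the number of all assignments. *)
Lemma side_probability (R : archiRealFieldType) (V E : finType) (d : V -> nat)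
    (delta : E -> nat) e e' :
  (\sum_v d v = \sum_e delta e)%N -> e != e' -> delta e = delta e' ->
  #|[set f in stub_assignments d delta | end_mset f e == end_mset f e']|%:R
     / #|stub_assignments d delta|%:R
  = (\sum_v d v - 2 * delta e)`!%:R / (\sum_v d v)`!%:R * side_sum R d (delta e) :> R.
Proof.
move=> sumd ne deq; rewrite side_sumE -card_balanced_labels.
have := congr1 (fun n => n%:R : R) (card_balanced_assignments sumd ne deq).
have := congr1 (fun n => n%:R : R) (card_stub_assignments sumd).
rewrite (bigD1 e) //= (bigD1 e') 1?eq_sym //= -deq !natrM.
have : (\prod_(x | (x != e) && (x != e')) (delta x)`!)%N%:R != 0 :> R.
  by rewrite pnatr_eq0 -lt0n prodn_gt0 // => x; rewrite fact_gt0.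
have f0 n : n`!%:R != 0 :> R by rewrite pnatr_eq0 -lt0n fact_gt0.
have := f0 (\sum_v d v)%N; have := f0 (delta e).
move: (_ - _)`!%:R (\sum_v d v)`!%:R (delta e)`!%:R (\prod_(x | _) _)%N%:R.
move: #|_|%:R #|_|%:R #|_|%:R => G B T M N K P K0 N0 P0 TN BN.
have T0 : T != 0 by apply: contraNneq N0 => T0; rewrite -TN T0 mul0r.
have -> : B = M * G / P by rewrite -BN mulfK.
rewrite -TN; field. by rewrite K0 P0 T0.
Qed.

Lemma end_mset_eq_size (V E : finType) (d : V -> nat) (delta : E -> nat)
    (f : {ffun stub d -> E}) e e' :
  f \in stub_assignments d delta -> end_mset f e = end_mset f e' -> delta e = delta e'.
Proof.
rewrite inE => /'forall_eqP fd /eqP; rewrite end_mset_eq => /'forall_eqP ee.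
rewrite -!fd.
have E1 x : #|[pred s | f s == x]| = #|[set s | f s == x]|.
  by apply: eq_card => s; rewrite !inE.
by rewrite !E1 -!sum_end_mult; apply: eq_bigr.
Qed.

Theorem theorem4 (R : archiRealFieldType) (V E : finType)
    (dout din : V -> nat) (dtail dhead : E -> nat)
    (sum_out : (\sum_(v : V) dout v = \sum_(e : E) dtail e)%N)
    (sum_in : (\sum_(v : V) din v = \sum_(e : E) dhead e)%N) :
  let n : R := #|V|%:R in
  let Eout : R := unif_mean [set: V] (fun v => (dout v)%:R) in
  let Ein : R := unif_mean [set: V] (fun v => (din v)%:R) in
  (forall e : E, (dtail e)%:R <= 2^-1 * n * Eout
              /\ (dhead e)%:R <= 2^-1 * n * Ein) ->
  unif_mean (dihypergraphs dout din dtail dhead)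
    (fun H => (num_multi_pairs H)%:R : R)
  = 2^-1 * \sum_(e : E)
      \sum_(e' : E | [&& e' != e, dtail e' == dtail e & dhead e' == dhead e])
        (fact_real (n * Eout - 2 * (dtail e)%:R)
           * fact_real (n * Ein - 2 * (dhead e)%:R)
         / (fact_real (n * Eout) * fact_real (n * Ein))
         * side_sum R dout (dtail e) * side_sum R din (dhead e)).
Proof.
move=> n Eout Ein hdeg.
have nEout : n * Eout = (\sum_v dout v)%N%:R by rewrite mul_card_unif_mean natr_sum.
have nEin : n * Ein = (\sum_v din v)%N%:R by rewrite mul_card_unif_mean natr_sum.
have half (N k : nat) : k%:R <= 2^-1 * N%:R :> R -> N%:R - 2 * k%:R = (N - 2 * k)%N%:R :> R.
  move=> kN; rewrite natrB ?natrM // -(ler_nat R) natrM; lra.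
set Omega := dihypergraphs _ _ _ _.
pose same e e' := #|[set H in Omega | same_hyperedge H e e']|.
have sameE e e' : same e e' =
  (#|[set f in stub_assignments dout dtail | end_mset f e == end_mset f e']|
   * #|[set f in stub_assignments din dhead | end_mset f e == end_mset f e']|)%N.
  rewrite -cardsX; apply: eq_card => -[f g]; rewrite [LHS]inE [RHS]inE /= /Omega /dihypergraphs.
  by rewrite in_setX /same_hyperedge /= !(in_set (fun _ => _ && _)) /= andbACA.
have -> : unif_mean Omega (fun H => (num_multi_pairs H)%:R : R)
  = 2^-1 * \sum_e \sum_(e' | e' != e) (same e e')%:R / #|Omega|%:R.
  rewrite /unif_mean; under [in RHS]eq_bigr do rewrite -mulr_suml -natr_sum.
  rewrite -mulr_suml -natr_sum mulrA; congr (_ / _).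
  apply: (mulfI (_ : 2%:R != 0 :> R)); rewrite ?pnatr_eq0 // mulVKf ?pnatr_eq0 //.
  rewrite -natr_sum -natrM mul2n -mul2n big_distrr /=; congr (_%:R).
  under eq_bigr do rewrite mul2n double_num_multi_pairs.
  rewrite exchange_big; apply: eq_bigr => e _; rewrite exchange_big; apply: eq_bigr => e' _.
  rewrite /same -sum1_card big_mkcond [RHS]big_mkcond; apply: eq_bigr => H _.
  by rewrite inE; case: (H \in Omega); case: same_hyperedge.
congr (_ * _); apply: eq_bigr => e _.
rewrite (bigID (fun e' => (dtail e' == dtail e) && (dhead e' == dhead e))) /=.
(* Equal hyperedges have equal degrees, so the other pairs contribute nothing. *)
rewrite [X in _ + X]big1 ?addr0 => [|e' /andP[_ /negP neq]]; last first.
  rewrite (_ : same e e' = 0%N) ?mul0r //; apply: eq_card0 => -[f g].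
  apply/negbTE/negP; rewrite inE => /andP[]; rewrite in_setX /= => /andP[fA gB] /andP[/eqP fe /eqP ge].
  by apply: neq; rewrite (end_mset_eq_size fA fe) (end_mset_eq_size gB ge) !eqxx.
apply: eq_bigr => e' /and3P[ne /eqP dt /eqP dh].
rewrite sameE /Omega cardsX !natrM invfM mulrACA.
have [ht hh] := hdeg e.
rewrite !side_probability // 1?eq_sym //.
rewrite -mulrA nEout in ht; rewrite -mulrA nEin in hh.
rewrite nEout nEin !half // !fact_real_nat invfM; ring.
Qed.
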